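(* Let $\kappa\in(0,1)$ and assume that $\nabla F$ is locally $\kappa$-Hölder continuous. Then the mapping $\nabla V_\infty$ is locally $\min\{q-1,\kappa\}$-Hölder continuous.
   Context: Let $n\ge 1$ be an integer and $q\in(1,\infty)$. $J_n$ is the $n\times n$ Jordan block with eigenvalue $0$ (ones on the superdiagonal, zeros elsewhere) and $e_n$ is the last canonical basis vector of $\mathbb{R}^n$. The control system is $\dot x=J_nx+e_nu$. The function $F:\mathbb{R}^n\to\mathbb{R}_{\ge 0}$ is continuously differentiable, convex and positive definite ($F(0)=0$, $F(x)>0$ for $x\ne0$). For $x_0\in\mathbb{R}^n$ and $u\in L^q(\mathbb{R}_{\ge0},\mathbb{R})$, $\mathcal{J}_\infty(x_0,u)=\int_0^\infty\left(\frac{|u(t)|^q}{q}+F(x(t))\right)dt$, where $x(\cdot)$ is the trajectory of the control system with $x(0)=x_0$ and control $u$; $V_\infty(x_0)=\inf_{u\in L^q(\mathbb{R}_{\ge0},\mathbb{R})}\mathcal{J}_\infty(x_0,u)$ is the value function, which is continuously differentiable on $\mathbb{R}^n$. For a $C^1$ function $f:\mathbb{R}^n\to\mathbb{R}$ and $\kappa\in(0,1)$, $\nabla f$ is locally $\kappa$-Hölder continuous if for every bounded set $U\subset\mathbb{R}^n$ there is $C>0$ (depending on $U$) such that $\|\nabla f(x)-\nabla f(y)\|\le C\|x-y\|^\kappa$ for all $x,y\in U$. *)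

(* Defs.v *)
From HB Require Import structures.
From mathcomp Require Import all_boot all_order all_algebra.
From mathcomp Require Import all_classical all_reals all_analysis.

Set Implicit Arguments.
Unset Strict Implicit.
Unset Printing Implicit Defensive.

Import Order.TTheory GRing.Theory Num.Theory.
Import numFieldNormedType.Exports.

Local Open Scope classical_set_scope.
Local Open Scope ring_scope.

Section Calculus.
Context {R : realType} {n : nat}.

(* The library's norm on matrices is the max norm. *)
Definition enorm (v : 'cV[R]_n) : R := Num.sqrt (\sum_(i < n) v i 0 ^+ 2).

Definition gradient (f : 'cV[R]_n -> R) (x : 'cV[R]_n) : 'cV[R]_n :=
  \col_i 'D_(delta_mx i 0) f x.

Definition C1 (f : 'cV[R]_n -> R) : Prop :=
  (forall x, differentiable f x) /\ continuous (gradient f).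

Definition locally_holder (kappa : R) (g : 'cV[R]_n -> 'cV[R]_n) : Prop :=
  forall U : set 'cV[R]_n, bounded_set U ->
    exists2 C : R, 0 < C &
      forall x y, U x -> U y -> enorm (g x - g y) <= C * enorm (x - y) `^ kappa.

End Calculus.

Section ControlProblem.
Context {R : realType}.

Local Notation mu := (@lebesgue_measure R).

Definition jordan0 (n : nat) : 'M[R]_n := \matrix_(i, j) (j == i.+1 :> nat)%:R.

Definition last_basis (n : nat) : 'cV[R]_n := \col_i (i.+1 == n)%:R.

(* Controls are functions on the whole line of which only the restriction to
   [0, +oo[ matters; u \_ A is u extended by 0 outside A. *)
Definition Lq_control (q : R) (u : R -> R) : Prop :=
  u \_ `[0, +oo[ \in Lfun mu q%:E.

(* Caratheodory solutions of x' = J_n x + e_n u, x(0) = x0, in integral form.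
   An L^q control is integrable on [0, t], and x is continuous there, so the
   integrand is integrable; the solution on [0, +oo[ is then unique. *)
Definition is_trajectory (n : nat) (x0 : 'cV[R]_n) (u : R -> R)
    (x : R -> 'cV[R]_n) : Prop :=
  {within `[0, +oo[, continuous x} /\
  forall t : R, 0 <= t -> forall i : 'I_n,
    x t i 0 = x0 i 0 +
      \int[mu]_(s in `[0, t]) (jordan0 n *m x s + u s *: last_basis n) i 0.

Definition cost (n : nat) (q : R) (F : 'cV[R]_n -> R) (u : R -> R)
    (x : R -> 'cV[R]_n) : \bar R :=
  (\int[mu]_(t in `[0%R, +oo[) (`|u t| `^ q / q + F (x t))%:E)%E.

(* The infimum is over L^q controls, each paired with its unique trajectory. *)
Definition value (n : nat) (q : R) (F : 'cV[R]_n -> R) (x0 : 'cV[R]_n) : \bar R :=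
  ereal_inf [set J | exists u x,
    [/\ Lq_control q u, is_trajectory x0 u x & J = cost q F u x]].

End ControlProblem.

(* Main.v *)
(** The value function is convex, being the infimum of a jointly convex cost over
    controls and trajectories that depend affinely on the initial state.  For a
    convex function, a local bound C|h|^(1+a) on the second differences
    V(x+h) + V(x-h) - 2V(x) yields a locally a-Hölder gradient.  To bound the second
    difference, perturb a nearly optimal pair (u, x) from x0 to (u±w, x±y), where the
    control w steers h to the origin in unit time and w, y = O(|h|).  The costs then
    differ only on [0, 1], where the second differences of |u|^q and of F are of
    orders min(q, 2) and 1+kappa.  Neither existence of optimal controls nor the
    maximum principle is involved. *)
Require Import Defs.
From HB Require Import structures.
From mathcomp Require Import all_boot all_order all_algebra.
From mathcomp Require Import all_classical all_reals all_analysis.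
From mathcomp Require Import measurable_realfun ring lra.

Set Implicit Arguments.
Unset Strict Implicit.
Unset Printing Implicit Defensive.

Import Order.TTheory GRing.Theory Num.Theory.
Import numFieldNormedType.Exports.

Local Open Scope classical_set_scope.
Local Open Scope ring_scope.

(** * Column vectors and gradients *)

Section ColumnVectors.
Context {R : realType} {n : nat}.
Implicit Types (g v w x h : 'cV[R]_n) (f : 'cV[R]_n -> R).

(** A nearly optimal control is only known to lie in L^q, so it may be unbounded, and for q > 2 the
    second difference of |u|^q is then not bounded by a constant times |w|^(1+a). The factor 1 +
    |u|^q is allowed instead: its integral over [0, 1] is controlled by the cost of (u, x). That
    cost is at most M + 1 uniformly for initial states in a ball, because each of them can be
    steered to the origin at cost at most M. The same cost bound confines x to a fixed ball on
    [0, 1], as it must, since the gradient of F is Hölder only locally. The tolerance of near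
    optimality is chosen after h and sent to zero with h fixed; no constant depends on it. *)

Definition dot g v : R := \sum_i g i 0 * v i 0.

Lemma dotDr g v w : dot g (v + w) = dot g v + dot g w.
Proof. by rewrite -big_split; apply: eq_bigr => i _; rewrite mxE mulrDr. Qed.

Lemma dotZr g a v : dot g (a *: v) = a * dot g v.
Proof. by rewrite mulr_sumr; apply: eq_bigr => i _; rewrite mxE mulrCA. Qed.

Lemma dotNr g v : dot g (- v) = - dot g v.
Proof. by rewrite -scaleN1r dotZr mulN1r. Qed.

Lemma dotBl g g' v : dot (g - g') v = dot g v - dot g' v.
Proof.
by rewrite -sumrB; apply: eq_bigr => i _; rewrite !mxE mulrBl.
Qed.

Lemma dot_delta g i a : dot g (a *: delta_mx i 0) = a * g i 0.
Proof.
rewrite dotZr /dot (bigD1 i)//= !mxE !eqxx mulr1 big1 ?addr0// => j ji.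
by rewrite mxE (negPf ji) mulr0.
Qed.

Lemma norm_coord_le v i : `|v i 0| <= `|v|.
Proof.
by rewrite [leRHS]/Num.norm /= mx_normrE; apply: (le_bigmax _ (fun ij => `|v ij.1 ij.2|) (i, 0)).
Qed.

Lemma norm_cV_le v c : 0 <= c -> (forall i, `|v i 0| <= c) -> `|v| <= c.
Proof.
move=> c0 vc; rewrite [leLHS]/Num.norm /= mx_normrE.
by apply/bigmax_leP; split => // -[i j] _ /=; rewrite ord1.
Qed.

Lemma norm_dot_le g v : `|dot g v| <= n%:R * `|g| * `|v|.
Proof.
apply: (le_trans (ler_norm_sum _ _ _)).
apply: (@le_trans _ _ (\sum_(i < n) `|g| * `|v|)).
  by apply: ler_sum => i _; rewrite normrM ler_pM// norm_coord_le.
by rewrite sumr_const card_ord -[leLHS]mulr_natl mulrA.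
Qed.

Lemma dot_linear g : exists df : {linear 'cV[R]_n -> R}, df = dot g :> (_ -> _).
Proof.
have dlin : linear (dot g) by move=> a u v; rewrite dotDr dotZr.
pose dL := GRing.isLinear.Build _ _ _ _ (dot g) dlin.
by exists (HB.pack (dot g) dL : {linear 'cV[R]_n -> R}).
Qed.

Lemma dot_continuous g : continuous (dot g).
Proof.
have [df dfE] := dot_linear g; rewrite -dfE; apply/bounded_linear_continuous/bounded_funP => r.
exists (n%:R * `|g| * r) => v vr.
by rewrite dfE (le_trans (norm_dot_le g v))// ler_wpM2l// mulr_ge0.
Qed.

Lemma enorm_ge0 v : 0 <= enorm v. Proof. exact: sqrtr_ge0. Qed.

Lemma enorm0 : enorm (0 : 'cV[R]_n) = 0.
Proof. by rewrite /enorm big1 ?sqrtr0// => i _; rewrite mxE expr0n. Qed.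

Lemma norm_le_enorm v : `|v| <= enorm v.
Proof.
apply: norm_cV_le => [|i]; first exact: enorm_ge0.
rewrite -sqrtr_sqr ler_wsqrtr// (bigD1 i)//= lerDl.
by apply: sumr_ge0 => j _; rewrite sqr_ge0.
Qed.

Lemma enorm_le_norm v : enorm v <= n%:R * `|v|.
Proof.
have nv0 : 0 <= n%:R * `|v| by rewrite mulr_ge0.
rewrite -[leRHS]ger0_norm// -sqrtr_sqr ler_wsqrtr//.
apply: (@le_trans _ _ (\sum_(i < n) `|v| ^+ 2)).
  by apply: ler_sum => i _; rewrite -real_normK ?num_real// lerXn2r ?nnegrE// norm_coord_le.
rewrite sumr_const card_ord -[leLHS]mulr_natl exprMn ler_wpM2r ?sqr_ge0//.
by rewrite -natrX ler_nat; case: (n) => // k; rewrite leq_pmulr.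
Qed.

Lemma enorm_sq v : enorm v ^+ 2 = dot v v.
Proof.
rewrite sqr_sqrtr; last by apply: sumr_ge0 => i _; rewrite sqr_ge0.
by apply: eq_bigr => i _; rewrite expr2.
Qed.

Lemma differentiable_littleo f x g :
  (forall e, 0 < e -> \forall h \near (0 : 'cV[R]_n), `|f (h + x) - (f x + dot g h)| <= e * `|h|) ->
  differentiable f x /\ gradient f x = g.
Proof.
move=> fg.
have [df dfE] := dot_linear g.
have dfc : continuous df by rewrite dfE; exact: dot_continuous.
have dE : 'd f x = df :> ('cV[R]_n -> R).
  by apply: diff_unique => //; rewrite dfE; apply/eqaddoP => e e0; exact: fg.
have Df : differentiable f x.
  apply/diff_locallyP; rewrite dE; split=> //.
  by rewrite dfE; apply/eqaddoP => e e0; exact: fg.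
split=> //; apply/colP => i; rewrite mxE deriveE// dE.
by rewrite dfE -[delta_mx _ _]scale1r dot_delta mul1r.
Qed.

Lemma gradient_dot f x v : differentiable f x -> 'D_v f x = dot (gradient f x) v.
Proof.
move=> df; rewrite deriveE// {1}(matrix_sum_delta v) linear_sum; apply: eq_bigr => i _.
by rewrite big_ord1 linearZ mxE -deriveE// mulrC.
Qed.

End ColumnVectors.

(** * Second differences of convex functions *)

Section ConvexFunctions.
Context {R : realType}.

Definition convex (E : lmodType R) (f : E -> R) :=
  forall x y t, 0 <= t -> t <= 1 ->
    f (t *: x + (1 - t) *: y) <= t * f x + (1 - t) * f y.

Lemma convex_functionT (E : lmodType R) (f : E -> R) :
  convex_function [set: E] f -> convex f.
Proof.
by move=> fc x y t t0 t1; have := fc (Itv01 t0 t1) x y; rewrite !inE; apply.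
Qed.

(** The average of m+2 points is the convex combination, with weight (m+1)/(m+2), of the average of
    the first m+1 points and the last point. *)
Lemma convex_jensen (E : lmodType R) (f : E -> R) (v : nat -> E) m :
  convex f ->
  f (m.+1%:R^-1 *: \sum_(i < m.+1) v i) <= m.+1%:R^-1 * \sum_(i < m.+1) f (v i).
Proof.
move=> fc; elim: m => [|m IH]; first by rewrite !big_ord1 invr1 scale1r mul1r.
rewrite big_ord_recr [in leRHS]big_ord_recr /=.
set s := \sum_(i < m.+1) v i; set w : R := m.+1%:R.
have w0 : 0 < w by rewrite ltr0n.
have -> : m.+2%:R = w + 1 :> R by rewrite -natr1.
have w1 : 0 < w + 1 by rewrite addr_gt0.
have t0 : 0 <= w / (w + 1) by rewrite divr_ge0 // ltW.
have t1 : w / (w + 1) <= 1 by rewrite ler_pdivrMr// mul1r lerDl.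
have tE : 1 - w / (w + 1) = (w + 1)^-1 by field; rewrite gt_eqF.
have := fc (w^-1 *: s) (v m.+1) _ t0 t1.
rewrite scalerA tE mulrAC divff ?gt_eqF// mul1r -scalerDr => /le_trans; apply.
rewrite mulrDr lerD2r mulrAC [leLHS]mulrC ler_wpM2l ?invr_ge0 ?(ltW w1)//.
by rewrite -ler_pdivlMl.
Qed.

(** Every left difference quotient at 0 is at most every right one, so the supremum of the left
    quotients is a slope that supports [phi] on both sides. *)
Lemma convex_subgradient1 (phi : R -> R) : convex (phi : R^o -> R) ->
  exists g, forall t, phi 0 + g * t <= phi t.
Proof.
move=> pc.
have slopes s t : 0 < s -> 0 < t -> (phi 0 - phi (- s)) / s <= (phi t - phi 0) / t.
  move=> s0 t0; have st : 0 < s + t by exact: addr_gt0.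
  have a0 : 0 <= t / (s + t) by rewrite divr_ge0 // ltW.
  have a1 : t / (s + t) <= 1 by rewrite ler_pdivrMr// mul1r lerDr ltW.
  have := pc (- s) t _ a0 a1.
  have -> : t / (s + t) *: (- s : R^o) + (1 - t / (s + t)) *: (t : R^o) = 0.
    by rewrite /GRing.scale /=; field; rewrite gt_eqF.
  have -> : t / (s + t) * phi (- s) + (1 - t / (s + t)) * phi t =
            (t * phi (- s) + s * phi t) / (s + t) by field; rewrite gt_eqF.
  rewrite ler_pdivlMr// => H; rewrite ler_pdivrMr// mulrAC ler_pdivlMr//; lra.
pose S := [set (phi 0 - phi (- s)) / s | s in [set s | 0 < s]].
have hS : has_sup S.
  split; first by exists ((phi 0 - phi (- 1)) / 1), 1 => //=; exact: ltr01.
  by exists ((phi 1 - phi 0) / 1) => _ [s s0 <-]; apply: slopes.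
exists (sup S) => t; have [t0|t0|->] := ltgtP t 0; last by rewrite mulr0 addr0.
- have : (phi 0 - phi (- (- t))) / (- t) <= sup S.
    by apply: (ub_le_sup hS.2); exists (- t) => //=; rewrite oppr_gt0.
  by rewrite opprK ler_pdivrMr ?oppr_gt0// => H; lra.
- have : sup S <= (phi t - phi 0) / t.
    by apply: (ge_sup hS.1) => _ [s s0 <-]; apply: slopes.
  by rewrite ler_pdivlMr// => H; lra.
Qed.

Lemma powR_le_small (a e : R) : 0 < a -> 0 < e ->
  exists2 d, 0 < d & forall t, 0 <= t -> t <= d -> t `^ a <= e.
Proof.
move=> a0 e0; exists (e `^ a^-1); first exact: powR_gt0.
move=> t t0 td; have -> : e = (e `^ a^-1) `^ a.
  by rewrite -powRrM mulVf ?gt_eqF// powRr1 // ltW.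
by rewrite ge0_ler_powR ?nnegrE ?powR_ge0// ltW.
Qed.

Lemma powRD1 (t a : R) : 0 <= t -> 0 < a -> t `^ (1 + a) = t * t `^ a.
Proof.
by move=> t0 a0; rewrite powRD ?powRr1//; apply/implyP; rewrite gt_eqF// addr_gt0.
Qed.

Context {n : nat}.
Implicit Types (x y h : 'cV[R]_n) (V : 'cV[R]_n -> R).

Lemma locally_holder_continuous (a : R) (g : 'cV[R]_n -> 'cV[R]_n) :
  0 < a -> locally_holder a g -> continuous g.
Proof.
move=> a0 hg x; apply/(@cvgrPdist_le _ _ _ (nbhs x)) => e e0.
have [|C C0 HC] := hg [set y | `|x - y| <= 1].
  exists (`|x| + 1); split=> [|M xM y /= xy]; first exact: num_real.
  rewrite (le_trans _ (ltW xM))// -[y](subKr x) (le_trans (ler_normB _ _))//.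
  by rewrite lerD2l.
have [d d0 Hd] := powR_le_small a0 (divr_gt0 e0 C0).
near=> y.
apply: (le_trans (norm_le_enorm _)).
apply: (le_trans (HC x y _ _)); first by rewrite /= subrr normr0.
  by near: y; apply: cvgr_dist_le.
rewrite mulrC -ler_pdivlMr// Hd ?enorm_ge0//.
apply: (le_trans (enorm_le_norm _)).
(* With [n.+1] in place of [n] the factor can be divided by even in dimension 0. *)
apply: (@le_trans _ _ (n.+1%:R * `|x - y|)); first by rewrite ler_wpM2r// ler_nat.
rewrite mulrC -ler_pdivlMr ?ltr0n//.
near: y; apply: cvgr_dist_le => //; rewrite divr_gt0//.
Unshelve. all: by end_near. Qed.

(** The bridge between second differences and the gradient: convexity is used to reach this
    expansion, but not to pass from it to a Hölder gradient. *)
Definition C1_expansion (a : R) V := forall r, exists2 C, 0 < C &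
  forall x h, `|x| <= r -> `|h| <= r ->
    `|V (x + h) - V x - dot (gradient V x) h| <= C * `|h| `^ (1 + a).

(* The expansions at x and y are compared at the test point y + w, where w is the
   multiple of the difference of the gradients with enorm w = `|x - y|. *)
Lemma C1_expansion_holder a V : 0 < a ->
  C1_expansion a V -> locally_holder a (gradient V).
Proof.
move=> a0 HV U [M [_ HM]].
have [r r0 Ur] : exists2 r, 0 <= r & forall x, U x -> `|x| <= r.
  exists (`|M| + 1) => // x Ux; apply: HM => //.
  by rewrite (le_lt_trans (ler_norm _))// ltrDl.
(* Since s = |x - y| is at most 2r, the longest increment used, y - x + w, has norm at most 2s <=
   4r. It also accounts for 2^(1+a) in [C']; the other two increments have norm at most s. *)
have [C C0 HC] := HV (4 * r).
pose C' := C * (2 `^ (1 + a) + 2).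
have C'0 : 0 < C' by rewrite mulr_gt0// addr_gt0// powR_gt0.
exists C' => //.
move=> x y Ux Uy.
have [->|xy] := eqVneq x y.
  by rewrite subrr enorm0 mulr_ge0 ?powR_ge0 ?(ltW C'0).
set d := gradient V x - gradient V y; set e := enorm d.
have [e0|e0] := leP e 0.
  by apply: (le_trans e0); rewrite mulr_ge0 ?powR_ge0// ltW.
set s := `|x - y|; have s0 : 0 < s by rewrite normr_gt0 subr_eq0.
suff es : e <= C' * s `^ a.
  apply: (le_trans es); rewrite ler_wpM2l ?(ltW C'0)//.
  by rewrite ge0_ler_powR ?nnegrE ?enorm_ge0 ?norm_le_enorm// ltW.
rewrite -(ler_pM2l s0) mulrCA -powRD1 ?(ltW s0)//.
pose w := (s / e) *: d.
have ws : `|w| <= s.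
  rewrite normrZ ger0_norm ?divr_ge0 ?(ltW s0) ?(ltW e0)// mulrAC ler_pdivrMr// ler_pM2l//.
  exact: norm_le_enorm.
have s2r : s <= 2 * r.
  by rewrite (le_trans (ler_normB _ _))// mulr2n mulrDl mul1r lerD// Ur.
have sE : `|y - x| = s by rewrite distrC.
have w2 : `|y - x + w| <= 2 * s.
  by rewrite (le_trans (ler_normD _ _))// sE mulr2n mulrDl mul1r lerD2l.
have r4 : r <= 4 * r by rewrite ler_peMl// ler1n.
have r24 : 2 * r <= 4 * r by rewrite ler_wpM2r// ler_nat.
have r22 : 2 * (2 * r) <= 4 * r by rewrite mulrA -natrM.
have xr := le_trans (Ur _ Ux) r4; have yr := le_trans (Ur _ Uy) r4.
have sr := le_trans s2r r24.
have dr : `|y - x + w| <= 4 * r by rewrite (le_trans w2)// (le_trans _ r22)// ler_pM2l.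
have yxr : `|y - x| <= 4 * r by rewrite sE.
have a1 : 0 <= 1 + a by rewrite addr_ge0// ltW.
have P2 : C * `|w| `^ (1 + a) <= C * s `^ (1 + a).
  by rewrite (ler_pM2l C0) (ge0_ler_powR a1) ?nnegrE ?(ltW s0).
have P3 : C * `|y - x + w| `^ (1 + a) <= C * (2 `^ (1 + a) * s `^ (1 + a)).
  rewrite (ler_pM2l C0) -(powRM _ (ler0n R 2) (ltW s0)).
  by rewrite (ge0_ler_powR a1) ?nnegrE ?mulr_ge0 ?(ltW s0).
(* In the sum of the expansions from x to y + w, from y to y + w and from x to y, with suitable
   signs, all values of V cancel. What remains is the gradient difference paired with w, which
   equals s * e. *)
have := HC x (y - x + w) xr dr; rewrite addrA subrKC dotDr => /ler_normlP[H3 _].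
have := HC y w yr (le_trans ws sr) => /ler_normlP[_ H2].
have := HC x (y - x) xr yxr; rewrite subrKC sE => /ler_normlP[_ H1].
have <- : dot (gradient V x) w - dot (gradient V y) w = s * e.
  by rewrite -dotBl -/d dotZr -enorm_sq -/e expr2 mulrA divfK ?gt_eqF.
have -> : C' * s `^ (1 + a) =
    C * (2 `^ (1 + a) * s `^ (1 + a)) + C * s `^ (1 + a) + C * s `^ (1 + a).
  by rewrite /C'; ring.
move: {P2 P3} (le_trans H3 P3) (le_trans H2 P2) H1.
move: (V _) (V _) (V _) (dot _ _) (dot _ _) (dot _ _) (C * _) (C * _) => *; lra.
Qed.

(* As h is the average of the vectors n h_i e_i, Jensen's inequality gives the upper
   bound from the coordinate directions; the lower bound is the upper one at -h. *)
Lemma convex_second_difference_expansion V (a C r : R) x :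
  convex V -> 0 <= C -> 0 <= a ->
  (forall h, `|h| <= r -> V (x + h) + V (x - h) - 2 * V x <= C * `|h| `^ (1 + a)) ->
  exists g, forall h, n%:R * `|h| <= r ->
    `|V (x + h) - V x - dot g h| <= C * (n%:R * `|h|) `^ (1 + a).
Proof.
move=> Vc C0 a0 HV.
have a1 : 0 <= 1 + a by rewrite addr_ge0.
have /choice[g Hg] : forall i : 'I_n, exists g, forall t,
    V x + g * t <= V (x + t *: delta_mx i 0).
  move=> i; have [|g Hg] := @convex_subgradient1 (fun t => V (x + t *: delta_mx i 0)).
    move=> s t b b0 b1; have := Vc (x + s *: delta_mx i 0) (x + t *: delta_mx i 0) b b0 b1.
    apply: le_trans; rewrite le_eqVlt; apply/orP; left; apply/eqP; congr V.
    rewrite !scalerDr addrACA -scalerDl subrKC scale1r; congr (_ + _).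
    by apply: (etrans (scalerDl _ _ _)); congr (_ + _); rewrite scalerA.
  by exists g => t; have := Hg t; rewrite scale0r addr0.
pose G : 'cV[R]_n := \col_i g i; exists G.
have up h : n%:R * `|h| <= r ->
    V (x + h) <= V x + dot G h + C * (n%:R * `|h|) `^ (1 + a).
  move=> hr; case: n => [|m] in x h V Vc HV g Hg G hr *.
    rewrite /dot big_ord0 addr0 (_ : x + h = x); last by apply/colP => -[].
    by rewrite lerDl mulr_ge0// powR_ge0.
  pose v k : 'cV[R]_m.+1 :=
    x + (m.+1%:R * h (inord k) 0) *: delta_mx (inord k) 0.
  have m0 : m.+1%:R != 0 :> R by rewrite pnatr_eq0.
  have -> : x + h = m.+1%:R^-1 *: \sum_(i < m.+1) v i.
    rewrite big_split /= sumr_const card_ord -[x *+ _]scaler_nat scalerDr scalerA mulVf// scale1r.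
    congr (_ + _); rewrite scaler_sumr {1}(matrix_sum_delta h); apply: eq_bigr => i _.
    by rewrite big_ord1 scalerA mulKf// inord_val.
  apply: (le_trans (convex_jensen _ _ Vc)).
  rewrite mulrC ler_pdivrMr ?ltr0n//.
  have -> : (V x + dot G h + C * (m.+1%:R * `|h|) `^ (1 + a)) * m.+1%:R =
    \sum_(i < m.+1) (V x + g i * (m.+1%:R * h i 0) + C * (m.+1%:R * `|h|) `^ (1 + a)).
    rewrite !big_split /= !sumr_const card_ord -[V x *+ _]mulr_natr -[(C * _) *+ _]mulr_natr.
    rewrite !mulrDl; congr (_ + _ + _).
    by rewrite /dot mulr_suml; apply: eq_bigr => i _; rewrite mxE; ring.
  apply: ler_sum => i _; rewrite /v inord_val.
  set t := m.+1%:R * h i 0.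
  have tE : `|t *: delta_mx i 0 : 'cV[R]_m.+1| <= m.+1%:R * `|h|.
    apply: norm_cV_le => [|j]; first by rewrite mulr_ge0.
    rewrite !mxE normrM /t normrM normr_nat -mulrA ler_wpM2l//.
    apply: (@le_trans _ _ `|h i 0|); last exact: norm_coord_le.
    by case: (_ && _); rewrite ?mulr1n ?mulr0n ?normr0 ?normr1 ?mulr0 ?mulr1.
  (* The second difference bounds V(x + t e_i) from above in terms of V(x - t e_i), and the
     subgradient inequality at - t bounds the latter from below. *)
  have := HV _ (le_trans tE hr).
  have := Hg i (- t); rewrite mulrN scaleNr.
  have : C * `|t *: delta_mx i 0 : 'cV[R]_m.+1| `^ (1 + a) <= C * (m.+1%:R * `|h|) `^ (1 + a).
    by rewrite ler_wpM2l// ge0_ler_powR ?nnegrE// mulr_ge0.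
  lra.
move=> h hr; have := up h hr; have := up (- h); rewrite normrN => /(_ hr); rewrite dotNr.
(* Midpoint convexity, 2V(x) <= V(x+h) + V(x-h), turns the upper bound at -h into a lower bound at
   h. *)
have := Vc (x + h) (x - h) 2^-1.
rewrite -[_ *: (x + h) + _](_ : x = _); last first.
  have -> : 1 - 2^-1 = 2^-1 :> R by lra.
  by rewrite -scalerDr addrACA subrr addr0 -mulr2n -[x *+ _]scaler_nat scalerA mulVf// scale1r.
move=> /(_ ltac:(lra) ltac:(lra)) H1 H2 H3.
by apply/ler_normlP; split; lra.
Qed.

Lemma convex_second_difference_C1_expansion V a : convex V -> 0 < a ->
  (forall r, exists2 C, 0 < C & forall x h, `|x| <= r -> `|h| <= r ->
     V (x + h) + V (x - h) - 2 * V x <= C * `|h| `^ (1 + a)) ->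
  (forall x, differentiable V x) /\ C1_expansion a V.
Proof.
move=> Vc a0 HV.
have key r : 0 < r -> exists2 C, 0 < C & forall x, `|x| <= r ->
    differentiable V x /\ forall h, `|h| <= r ->
    `|V (x + h) - V x - dot (gradient V x) h| <= C * `|h| `^ (1 + a).
  (* The expansion at h needs second differences for increments up to n|h|. The extra 1 keeps the
     base points in the ball when n = 0. *)
  move=> r0; have [C C0 HC] := HV (n.+1%:R * r).
  exists (C * n.+1%:R `^ (1 + a)); first by rewrite mulr_gt0// powR_gt0.
  move=> x xr.
  have xr' : `|x| <= n.+1%:R * r by rewrite (le_trans xr)// ler_peMl ?ler1n// ltW.
  have [g Hg] := convex_second_difference_expansion Vc (ltW C0) (ltW a0)
    (fun h => HC x h xr').
  have {}Hg h : `|h| <= r ->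
      `|V (x + h) - V x - dot g h| <= C * n.+1%:R `^ (1 + a) * `|h| `^ (1 + a).
    move=> hr; apply: (le_trans (Hg h _)).
      by rewrite ler_pM// ler_nat.
    rewrite -mulrA ler_wpM2l ?(ltW C0)// -powRM// ge0_ler_powR ?nnegrE//.
      by rewrite addr_ge0 // ltW.
    by rewrite ler_wpM2r// ler_nat.
  (* So far g is only a vector of one-dimensional subgradients; the remainder of order 1 + a is
     o(|h|), which identifies it as the gradient. *)
  suff [dV gV] : differentiable V x /\ gradient V x = g by rewrite gV.
  apply: differentiable_littleo => e e0.
  have K0 : 0 < C * n.+1%:R `^ (1 + a) by rewrite mulr_gt0// powR_gt0.
  have [d d0 Hd] := powR_le_small a0 (divr_gt0 e0 K0).
  near=> h.
  have -> : V (h + x) - (V x + dot g h) = V (x + h) - V x - dot g h.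
    by rewrite opprD addrA [h + x]addrC.
  apply: (le_trans (Hg h _)).
    by near: h; apply: (@nbhs0_le _ 'cV[R]_n).
  by rewrite (powRD1 (normr_ge0 h) a0) mulrCA mulrC ler_wpM2r// mulrC -ler_pdivlMr// Hd//.
split=> [x|r].
  have [|C _ /(_ x)[]//] := key (`|x| + 1); first by rewrite ltr_wpDl.
  by rewrite lerDl.
have [|C C0 HC] := key (`|r| + 1); first by rewrite ltr_wpDl.
have rr b : b <= r -> b <= `|r| + 1.
  by move=> br; rewrite (le_trans br)// (le_trans (ler_norm r))// lerDl.
by exists C => // x h /rr xr /rr hr; exact: (HC x xr).2.
Unshelve. all: by end_near. Qed.

End ConvexFunctions.

(** * Second differences of the running cost *)

Section PowerSecondDifference.
Context {R : realType}.
Implicit Types (p q a x y b w : R).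

(** For p > 1 this is Young's inequality with exponents p/(p-1) and p, applied to x^(p-1) and y. No
    derivative is taken, so x = 0 needs no separate treatment. *)
Lemma powR_tangent p x y : 1 <= p -> 0 <= x -> 0 <= y ->
  x `^ p + p * x `^ (p - 1) * (y - x) <= y `^ p.
Proof.
rewrite le_eqVlt => /predU1P[<- x0 y0|p1 x0 y0].
  by rewrite subrr powRr0 !powRr1// !mul1r addrC subrK.
have p0 : 0 < p by rewrite (lt_trans _ p1).
have p10 : 0 < p - 1 by rewrite subr_gt0.
have p'E : (p / (p - 1))^-1 + p^-1 = 1 by field; rewrite !gt_eqF.
have := conjugate_powR (powR_ge0 x (p - 1)) y0 (divr_gt0 p0 p10) p0 p'E.
rewrite -powRrM [(p - 1) * _]mulrC divfK ?gt_eqF// => H.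
have {}H : p * (x `^ (p - 1) * y) <= (p - 1) * x `^ p + y `^ p.
  have -> : (p - 1) * x `^ p + y `^ p = p * (x `^ p / (p / (p - 1)) + y `^ p / p).
    by field; rewrite !gt_eqF.
  by rewrite ler_pM2l.
have E := mulr_powRB1 x0 p0; rewrite mulrBr -!mulrA [x `^ (p - 1) * x]mulrC E; lra.
Qed.

(** The fractions x/(x+y) and y/(x+y) sum to 1, and each is at most its own p-th power. *)
Lemma powR_subadd p x y : 0 < p -> p <= 1 -> 0 <= x -> 0 <= y ->
  (x + y) `^ p <= x `^ p + y `^ p.
Proof.
move=> p0 p1; rewrite le_eqVlt => /predU1P[<- y0|x0].
  by rewrite add0r powR0 ?gt_eqF// add0r.
rewrite le_eqVlt => /predU1P[<-|y0]; first by rewrite addr0 powR0 ?gt_eqF// addr0.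
have s0 : 0 < x + y by exact: addr_gt0.
have frac u v : 0 < u -> 0 < v -> u / (u + v) <= (u / (u + v)) `^ p.
  move=> u0 v0; rewrite ger1_powR// divr_gt0 ?addr_gt0//=.
  by rewrite ler_pdivrMr ?addr_gt0// mul1r lerDl ltW.
have sp : 0 < (x + y) `^ p by rewrite powR_gt0.
have E u : 0 <= u -> u `^ p = (u / (x + y)) `^ p * (x + y) `^ p.
  by move=> u0; rewrite -powRM ?divfK ?gt_eqF ?divr_ge0// ltW.
rewrite (E x) ?(ltW x0)// (E y) ?(ltW y0)// -mulrDl ler_peMl ?(ltW sp)//.
have := frac _ _ x0 y0; have := frac _ _ y0 x0; rewrite [y + x]addrC => H1 H2.
apply: le_trans (lerD H2 H1).
by rewrite -mulrDl divff ?gt_eqF.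
Qed.

Lemma powR_diff_le1 p x y : 0 < p -> p <= 1 -> 0 <= y -> y <= x ->
  x `^ p - y `^ p <= (x - y) `^ p.
Proof.
move=> p0 p1 y0 yx; rewrite lerBlDr -{1}(subrK y x).
by rewrite powR_subadd// subr_ge0.
Qed.

Lemma powR_diff_ge1 p x y : 1 <= p -> 0 <= y -> y <= x ->
  x `^ p - y `^ p <= p * x `^ (p - 1) * (x - y).
Proof.
move=> p1 y0 yx; have := powR_tangent p1 (le_trans y0 yx) y0.
by rewrite -(opprB x y) mulrN; lra.
Qed.

(** On a bounded range a surplus exponent is traded for a constant; this brings all orders down to
    the common 1 + a. *)
Lemma powR_split_le (M q c w : R) : 0 <= w -> w <= M -> 0 < c -> c <= q ->
  w `^ q <= M `^ (q - c) * w `^ c.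
Proof.
move=> w0 wM c0 cq.
have -> : w `^ q = w `^ (q - c) * w `^ c.
  by rewrite -powRD subrK//; apply/implyP; rewrite gt_eqF// (lt_le_trans c0).
rewrite ler_wpM2r ?powR_ge0// ge0_ler_powR ?nnegrE ?subr_ge0//.
exact: le_trans wM.
Qed.

(** Changing the sign of b or w at most swaps the two terms, so second differences need only be
    estimated for nonnegative arguments. *)
Lemma powR_norm_pair q b w :
  `|b + w| `^ q + `|b - w| `^ q = (`|b| + `|w|) `^ q + `| `|b| - `|w| | `^ q.
Proof.
wlog b0 : b w / 0 <= b => [W|].
  have [/W//|/ltW b0] := leP 0 b.
  have := W (- b) (- w); rewrite oppr_ge0 => /(_ b0).
  by rewrite !normrN opprK -opprD normrN [- b + w]addrC distrC.
rewrite (ger0_norm b0).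
have [w0|w0] := leP 0 w.
  by rewrite (ger0_norm w0) (ger0_norm (addr_ge0 b0 w0)).
rewrite (ltr0_norm w0) opprK [LHS]addrC; congr (_ `^ _ + _).
by rewrite ger0_norm// subr_ge0 (le_trans (ltW w0)).
Qed.

(** The growth in b is real for q > 2, where the second difference behaves like b^(q-2) w^2 for
    large b. It is weakened to 1 + |b|^q because that is what the cost can integrate. *)
Lemma powR_second_difference q a (M : R) : 1 < q -> 0 < a -> a <= 1 ->
  a <= q - 1 -> 0 <= M ->
  exists2 K, 0 < K & forall b w, `|w| <= M ->
    `|b + w| `^ q + `|b - w| `^ q - 2 * `|b| `^ q
      <= K * (1 + `|b| `^ q) * `|w| `^ (1 + a).
Proof.
move=> q1 a0 a1 aq M0.
have q0 : 0 < q by rewrite (lt_trans _ q1).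
have p0 : 0 < q - 1 by rewrite subr_gt0.
have aq' : 1 + a <= q by lra.
have a1' : 0 < 1 + a by lra.
pose K1 := (2 `^ q + 1) * M `^ (q - (1 + a)).
pose K2 := q * 2 `^ (q - 1) * M `^ (q - (1 + a)).
pose K3 := q * (q - 1) * 2 `^ (q - 2) * 2 * M `^ (2 - (1 + a)).
have K10 : 0 <= K1 by rewrite mulr_ge0 ?addr_ge0 ?powR_ge0.
have K20 : 0 <= K2 by rewrite !mulr_ge0 ?powR_ge0 // ltW.
have K30 : 0 <= K3 by rewrite !mulr_ge0 ?powR_ge0 // ltW.
exists (K1 + K2 + K3 + 1) => [|b w wM]; first by rewrite ltr_wpDl ?addr_ge0.
rewrite powR_norm_pair.
move: {b w} `|b| `|w| (normr_ge0 b) (normr_ge0 w) wM => b w b0 w0 wM.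
have bq0 : 0 <= b `^ q by exact: powR_ge0.
have P0 : 0 <= w `^ (1 + a) by exact: powR_ge0.
suff : exists2 k, k \in [:: K1; K2; K3] &
    (b + w) `^ q + `|b - w| `^ q - 2 * b `^ q <= k * (1 + b `^ q) * w `^ (1 + a).
  move=> [k kK /le_trans]; apply; rewrite ler_wpM2r// ler_wpM2r ?addr_ge0//.
  by move: kK; rewrite !inE => /or3P[] /eqP->; lra.
have wq := powR_split_le w0 wM a1' aq'.
have [bw|wb] := ltP b w.
  exists K1; first by rewrite !inE eqxx.
  have H1 : (b + w) `^ q <= 2 `^ q * w `^ q.
    rewrite -powRM// ge0_ler_powR ?nnegrE ?addr_ge0 ?mulr_ge0// ?(ltW q0)//.
    by rewrite mulr2n mulrDl mul1r lerD2r ltW.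
  have H2 : `|b - w| `^ q <= w `^ q.
    rewrite ge0_ler_powR ?nnegrE// ?(ltW q0)// distrC ger0_norm ?subr_ge0 ?(ltW bw)//.
    by rewrite gerBl.
  apply: (@le_trans _ _ ((2 `^ q + 1) * w `^ q)); first by lra.
  apply: (@le_trans _ _ (K1 * w `^ (1 + a))).
    by rewrite /K1 -mulrA ler_wpM2l// addr_ge0 ?powR_ge0.
  by rewrite ler_wpM2r// ler_peMr// lerDl.
have bmw0 : 0 <= b - w by rewrite subr_ge0.
have bpw0 : 0 <= b + w by rewrite addr_ge0.
rewrite (ger0_norm bmw0).
(* The tangents at b + w and b - w, both evaluated at b, reduce the second difference to a first
   difference of t^(q-1). *)
have D : (b + w) `^ q + (b - w) `^ q - 2 * b `^ q <=
    q * w * ((b + w) `^ (q - 1) - (b - w) `^ (q - 1)).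
  have := powR_tangent (ltW q1) bpw0 b0; have := powR_tangent (ltW q1) bmw0 b0.
  have -> : b - (b - w) = w by ring.
  have -> : b - (b + w) = - w by ring.
  move: (_ `^ q) (_ `^ q) (_ `^ q) (_ `^ (q - 1)) (_ `^ (q - 1)) => *; lra.
have wwE : b + w - (b - w) = 2 * w by ring.
have wle : b - w <= b + w by lra.
have qw0 : 0 <= q * w by rewrite mulr_ge0 // ltW.
(* For q <= 2 the power t^(q-1) is (q-1)-Hölder, with no dependence on b; for q > 2 its slope is at
   most (q-1)(b+w)^(q-2). *)
have [p1|p1] := leP (q - 1) 1.
  exists K2; first by rewrite !inE eqxx orbT.
  have := powR_diff_le1 p0 p1 bmw0 wle; rewrite wwE powRM// => H.
  apply: (le_trans D).
  apply: (@le_trans _ _ (q * w * (2 `^ (q - 1) * w `^ (q - 1)))).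
    by rewrite ler_wpM2l.
  have -> : q * w * (2 `^ (q - 1) * w `^ (q - 1)) = q * 2 `^ (q - 1) * w `^ q.
    by rewrite -(mulr_powRB1 w0 q0); ring.
  apply: (@le_trans _ _ (K2 * w `^ (1 + a))).
    by rewrite /K2 -[leRHS]mulrA ler_wpM2l// mulr_ge0 ?powR_ge0 // ltW.
  by rewrite ler_wpM2r// ler_peMr// lerDl.
exists K3; first by rewrite !inE eqxx !orbT.
have := powR_diff_ge1 (ltW p1) bmw0 wle; rewrite wwE (_ : q - 1 - 1 = q - 2); last by ring.
move=> H; apply: (le_trans D).
have q20 : 0 <= q - 2 by lra.
have Hb : (b + w) `^ (q - 2) <= 2 `^ (q - 2) * (1 + b `^ q).
  apply: (@le_trans _ _ (2 `^ (q - 2) * b `^ (q - 2))).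
    rewrite -powRM// ge0_ler_powR ?nnegrE ?mulr_ge0//.
    by rewrite mulr2n mulrDl mul1r lerD2l.
  rewrite ler_wpM2l ?powR_ge0//; have [b1|b1] := leP b 1.
    apply: (@le_trans _ _ 1); last by rewrite lerDl.
    have one : 1 `^ (q - 2) = 1 :> R by rewrite powR1.
    by rewrite -[leRHS]one ge0_ler_powR ?nnegrE.
  apply: (@le_trans _ _ (b `^ q)); last by rewrite lerDr.
  by apply: ler_powR; [exact: ltW|lra].
have w2 : w * w <= M `^ (2 - (1 + a)) * w `^ (1 + a).
  have := powR_split_le w0 wM a1' (_ : 1 + a <= 2).
  rewrite (_ : w `^ 2 = w * w); last by rewrite (powR_mulrn 2 w0) expr2.
  by apply; lra.
have c0 : 0 <= q * (q - 1) * 2 by rewrite !mulr_ge0 // ltW.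
apply: (@le_trans _ _ (q * (q - 1) * 2 * ((b + w) `^ (q - 2) * (w * w)))).
  have -> : q * (q - 1) * 2 * ((b + w) `^ (q - 2) * (w * w)) =
    q * w * ((q - 1) * (b + w) `^ (q - 2) * (2 * w)) by ring.
  by rewrite ler_wpM2l.
have -> : K3 * (1 + b `^ q) * w `^ (1 + a) = q * (q - 1) * 2 *
    (2 `^ (q - 2) * (1 + b `^ q) * (M `^ (2 - (1 + a)) * w `^ (1 + a))).
  by rewrite /K3; ring.
by rewrite ler_wpM2l// ler_pM ?powR_ge0 ?mulr_ge0.
Qed.

End PowerSecondDifference.

(** * Convex functions with locally Hölder gradient *)

Section ConvexTangent.
Context {R : realType} {n : nat}.
Implicit Types (x y v : 'cV[R]_n) (F : 'cV[R]_n -> R).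

Lemma convex_tangent F x y : convex F -> differentiable F x ->
  F x + dot (gradient F x) (y - x) <= F y.
Proof.
move=> Fc dF; rewrite -lerBrDl -gradient_dot//; set v := y - x.
have cv : (h^-1 *: ((F \o shift x) (h *: v) - F x) @[h --> 0^'] --> 'D_v F x).
  exact: (diff_derivable dF).
apply: (ler_cvg_to (cvg_dnbhs_at_right cv) (cvg_cst (F y - F x))).
near=> h.
have h0 : 0 < h by near: h; exact: nbhs_right_gt.
have h1 : h <= 1 by near: h; apply: nbhs_right_le.
rewrite /GRing.scale /= ler_pdivrMl//.
have -> : h *: v + x = h *: y + (1 - h) *: x.
  by rewrite scalerBr scalerBl scale1r -addrA [- _ + x]addrC.
by have := Fc y x h (ltW h0) h1; lra.
Unshelve. all: by end_near. Qed.

(** The tangents at x + y and x - y, both evaluated at x, bound the second difference by the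
    gradient difference between these points, which are 2y apart, paired with y. *)
Lemma convex_holder_second_difference F (kappa : R) : 0 < kappa -> convex F ->
  (forall x, differentiable F x) -> locally_holder kappa (gradient F) ->
  forall r, exists2 C, 0 < C & forall x y, `|x| <= r -> `|y| <= r ->
    F (x + y) + F (x - y) - 2 * F x <= C * `|y| `^ (1 + kappa).
Proof.
move=> k0 Fc dF gF r.
have [|C C0 HC] := gF [set x | `|x| <= r + r].
  exists (r + r); split=> [|M xM y /= xy]; first exact: num_real.
  by rewrite (le_trans xy)// ltW.
exists (n.+1%:R * C * (n.+1%:R * 2) `^ kappa); first by rewrite !mulr_gt0// powR_gt0// mulr_gt0.
move=> x y xr yr.
have := convex_tangent x Fc (dF (x + y)); have := convex_tangent x Fc (dF (x - y)).
have -> : x - (x - y) = y by rewrite opprB addrC subrK.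
have -> : x - (x + y) = - y by rewrite opprD addrA subrr sub0r.
rewrite dotNr => H1 H2.
set d := gradient F (x + y) - gradient F (x - y).
have dn : dot d y <= n%:R * `|d| * `|y|.
  exact: le_trans (ler_norm _) (norm_dot_le _ _).
have dC : `|d| <= C * (n.+1%:R * 2) `^ kappa * `|y| `^ kappa.
  apply: (le_trans (norm_le_enorm _)); apply: (le_trans (HC _ _ _ _)) => /=.
  - by rewrite (le_trans (ler_normD _ _))// lerD.
  - by rewrite (le_trans (ler_normB _ _))// lerD.
  rewrite -mulrA ler_wpM2l ?(ltW C0)// -powRM// ?mulr_ge0//.
  rewrite ge0_ler_powR ?nnegrE ?enorm_ge0 ?mulr_ge0// ?(ltW k0)//.
  apply: (le_trans (enorm_le_norm _)).
  rewrite opprB addrC addrA subrK -mulr2n -mulrA.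
  by rewrite normrMn -[`|y| *+ 2]mulr_natl ler_wpM2r ?mulr_ge0// ler_nat.
have -> : n.+1%:R * C * (n.+1%:R * 2) `^ kappa * `|y| `^ (1 + kappa) =
   n.+1%:R * (C * (n.+1%:R * 2) `^ kappa * `|y| `^ kappa) * `|y|.
  by rewrite (powRD1 _ k0)//; ring.
apply: (@le_trans _ _ (dot d y)).
  by rewrite dotBl; move: H1 H2; move: (F _) (F _) (F _) (dot _ _) (dot _ _) => *; lra.
apply: (le_trans dn); rewrite ler_wpM2r// ler_pM// ler_nat//.
Qed.

(** The tangent at x evaluated at the origin bounds F(x) - F(0) by the gradient at x paired with x;
    the Hölder bound compares that gradient with the one at 0. *)
Lemma convex_holder_bounded F (kappa : R) : 0 < kappa -> convex F ->
  (forall x, differentiable F x) -> locally_holder kappa (gradient F) ->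
  forall r, exists2 C, 0 < C & forall x, `|x| <= r -> F x <= C.
Proof.
move=> k0 Fc dF gF r.
have [|C C0 HC] := gF [set x | `|x| <= `|r|].
  exists `|r|; split=> [|M xM y /= xy]; first exact: num_real.
  by rewrite (le_trans xy)// ltW.
pose B := `|gradient F 0| + C * (n%:R * `|r|) `^ kappa.
exists (`|F 0| + n%:R * B * `|r| + 1) => [|x xr].
  by rewrite ltr_wpDl// addr_ge0// !mulr_ge0// addr_ge0// mulr_ge0 ?powR_ge0// ltW.
have xr' : `|x| <= `|r| by rewrite (le_trans xr)// ler_norm.
have := convex_tangent 0 Fc (dF x); rewrite sub0r dotNr => H.
have dn : dot (gradient F x) x <= n%:R * `|gradient F x| * `|x|.
  exact: le_trans (ler_norm _) (norm_dot_le _ _).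
have gB : `|gradient F x| <= B.
  rewrite -(subrK (gradient F 0) (gradient F x)) addrC (le_trans (ler_normD _ _))// lerD2l.
  apply: (le_trans (norm_le_enorm _)); apply: (le_trans (HC _ _ _ _)) => //=.
    by rewrite normr0.
  rewrite ler_wpM2l ?(ltW C0)// ge0_ler_powR ?nnegrE ?enorm_ge0 ?mulr_ge0// ?(ltW k0)//.
  by rewrite subr0 (le_trans (enorm_le_norm _))// ler_wpM2l.
have : n%:R * `|gradient F x| * `|x| <= n%:R * B * `|r|.
  by rewrite ler_pM ?mulr_ge0// ler_wpM2l.
have := ler_norm (F 0); lra.
Qed.

End ConvexTangent.

(** * Steering to the origin and trajectories *)

Section Steering.
Context {R : realType}.
Local Notation mu := (@lebesgue_measure R).
Implicit Types (p : {poly R}).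

(** Each differentiation lowers the multiplicity of the root c by at most one. *)
Lemma horner_derivn_root p (c : R) m j : (j < m)%N ->
  ((p * ('X - c%:P) ^+ m)^`(j)).[c] = 0.
Proof.
elim: j m p => [|j IH] [|m] p // jm.
  by rewrite derivn0 hornerM exprS hornerM hornerXsubC subrr mul0r mulr0.
rewrite derivSn derivM deriv_exp derivXsubC mul1r.
have -> : p^`() * ('X - c%:P) ^+ m.+1 + p * (('X - c%:P) ^+ m.+1.-1 *+ m.+1) =
    (p^`() * ('X - c%:P) + p *+ m.+1) * ('X - c%:P) ^+ m.
  by rewrite mulrDl exprS mulrA mulrnAl mulrnAr.
exact: IH.
Qed.

(* Bezout for the coprime polynomials X^n and (1 - X)^n. *)
Lemma steering_poly n (i : 'I_n) : exists p : {poly R},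
  forall j, (j < n)%N -> (p^`(j)).[0] = (i == j :> nat)%:R /\ (p^`(j)).[1] = 0.
Proof.
have cop : coprimep ('X ^+ n) (('X - 1%:P) ^+ n : {poly R}).
  by rewrite coprimep_expl// coprimep_expr// coprimep_XsubC /root hornerX oner_eq0.
have [[u v] /= uv] := Bezout_eq1_coprimepP _ _ cop.
(* The factor v(X-1)^n equals 1 - uX^n, so the product agrees with X^i/i! modulo X^n, which fixes
   the derivatives at 0, and has a root of order at least n at 1. *)
exists ((i`!%:R^-1)%:P * 'X^i * v * ('X - 1%:P) ^+ n) => j jn; split; last first.
  exact: horner_derivn_root.
rewrite horner_coef0 coef_derivn addn0 ffactnn.
have -> : (i`!%:R^-1)%:P * 'X^i * v * ('X - 1%:P) ^+ n =
   (i`!%:R^-1)%:P * 'X^i - (i`!%:R^-1)%:P * 'X^i * u * 'X^n.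
  have vE : v * ('X - 1%:P) ^+ n = 1 - u * 'X^n.
    by rewrite -[LHS](addKr (u * 'X^n)) uv addrC.
  by rewrite -mulrA vE mulrBr mulr1 mulrA.
rewrite coefB [X in _ - X]coefMXn jn subr0 coefCM coefXn eq_sym.
case: eqP => [->|_]; last by rewrite mulr0 mul0rn.
by rewrite mulr1 -[LHS]mulr_natr mulVf// pnatr_eq0 -lt0n fact_gt0.
Qed.

Lemma horner_bound p : exists2 C : R, 0 < C & forall t, 0 <= t -> t <= 1 -> `|p.[t]| <= C.
Proof.
exists (\sum_(i < size p) `|p`_i| + 1) => [|t t0 t1].
  by rewrite ltr_wpDl// sumr_ge0.
rewrite horner_coef; apply: (le_trans (ler_norm_sum _ _ _)).
apply: (@le_trans _ _ (\sum_(i < size p) `|p`_i|)); last by rewrite lerDl.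
apply: ler_sum => i _; rewrite normrM ler_piMr// normrX (ger0_norm t0).
exact: exprn_ile1.
Qed.

(** The interval is open at 1 so that the result vanishes from time 1 on even if p(1) is nonzero, as
    may happen for the control. *)
Definition stopped p : R -> R := horner p \_ `]-oo, 1[.

Lemma stoppedE p t : stopped p t = if t < 1 then p.[t] else 0.
Proof. by rewrite /stopped patchE mem_setE in_itv. Qed.

Lemma stopped_continuous p : p.[1] = 0 -> continuous (stopped p).
Proof.
move=> p1; have -> : stopped p = horner p \o (fun t => Num.min t 1).
  by apply/funext => t /=; rewrite stoppedE minElt; case: ifP => // _; rewrite p1.
move=> t; apply: continuous_comp; last exact: continuous_horner.
by apply: continuous_min => //; exact: cst_continuous.
Qed.

Lemma integral_stopped p t : p.[1] = 0 -> 0 <= t ->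
  stopped p t = p.[0] + \int[mu]_(s in `[0, t]) stopped p^`() s.
Proof.
move=> p1 t0.
have FTC b : 0 <= b -> \int[mu]_(s in `[0, b]) (p^`()).[s] = p.[b] - p.[0].
  rewrite le_eqVlt => /predU1P[<-|b0]; first by rewrite set_itv1 Rintegral_set1 subrr.
  rewrite /Rintegral (@continuous_FTC2 _ _ (horner p))//.
  - by apply: continuous_subspaceT => x; exact: continuous_horner.
  - split; first by move=> x _; exact: derivable_horner.
      by apply: cvg_at_right_filter; exact: continuous_horner.
    by apply: cvg_at_left_filter; exact: continuous_horner.
  - by move=> x _; rewrite derivE.
rewrite -Rintegral_mkcondr stoppedE.
have [t1|t1] := ltP t 1.
  rewrite setIidl ?FTC// ?subrKC// => s /=; rewrite !in_itv /= => /andP[_ st].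
  exact: le_lt_trans t1.
have -> : `[0, t] `&` `]-oo, 1[ = `[0, 1[%classic :> set R.
  apply/seteqP; split=> s /=; rewrite !in_itv /=.
    by move=> [/andP[-> _] ->].
  by move=> /andP[-> s1]; split=> //; rewrite (le_trans (ltW s1)).
rewrite Rintegral_itv_bndo_bndc ?FTC ?p1 ?sub0r ?subrr//.
apply: (@integrableS _ _ _ mu `[0, 1]) => //; first exact: subset_itv_co_cc.
apply: continuous_compact_integrable; first exact: segment_compact.
by apply: continuous_subspaceT => x; exact: continuous_horner.
Qed.

End Steering.

(** * L^q controls and linearity of the dynamics *)

Section Trajectories.
Context {R : realType}.
Local Notation mu := (@lebesgue_measure R).
Implicit Types (u w : R -> R) (q t : R).

Lemma Lq_control_measurable q u : Lq_control q u -> measurable_fun (`[0, +oo[%classic : set R) u.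
Proof. by move=> /andP[/[!inE] um _]; apply/measurable_restrictT. Qed.

Lemma Lq_control_integrable_powR q u : 1 <= q -> Lq_control q u ->
  mu.-integrable `[0, +oo[ (fun t => (`|u t| `^ q)%:E).
Proof.
move=> q1 uq; have ui := Lfun_integrable q1 uq.
apply: (@eq_integrable _ _ _ mu _ _ (fun t => (`|(u \_ `[0, +oo[) t| `^ q)%:E)) => //.
  by move=> t; rewrite inE /= => t0; rewrite patchE mem_set.
exact: (integrableS measurableT).
Qed.

Lemma Lq_control_lin q u w (a b : R) : 1 <= q -> Lq_control q u -> Lq_control q w ->
  Lq_control q (fun t => a * u t + b * w t).
Proof.
move=> q1 uq wq; have [S0 SL] := Lfun_submod_closed mu (q1 : (1 <= q%:E)%E).
rewrite /Lq_control.
have -> : (fun t => a * u t + b * w t) \_ `[0, +oo[ =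
    a *: u \_ `[0, +oo[ + (b *: w \_ `[0, +oo[ + 0).
  apply/funext => t; rewrite addr0 /= patchE; case: ifPn => tD.
    by rewrite !fctE !patchE tD.
  by rewrite !fctE !patchE (negPf tD) !scaler0 addr0.
by apply: (SL) => //; apply: (SL).
Qed.

Lemma lebesgue_measure_itv0 t : 0 <= t -> mu `[0, t]%classic = t%:E.
Proof.
rewrite lebesgue_measure_itv /= lte_fin le_eqVlt => /predU1P[<-|t0].
  by rewrite ltxx.
by rewrite t0 sube0.
Qed.

Lemma integral_indic01 (D : set R) : measurable D -> `[0, 1]%classic `<=` D ->
  (\int[mu]_(t in D) (\1_(`[0, 1]%classic : set R) t)%:E = 1)%E.
Proof.
move=> mD D01; rewrite integral_indic// setIidl//.
exact: (lebesgue_measure_itv0 ler01).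
Qed.

Lemma Lq_control_bounded q u (C : R) : 0 < q -> measurable_fun (`[0, +oo[%classic : set R) u ->
  (forall t, 0 <= t -> `|u t| <= C) -> (forall t, 1 <= t -> u t = 0) ->
  Lq_control q u.
Proof.
move=> q0 um uC u1; have um' : measurable_fun setT (u \_ `[0, +oo[).
  exact: (iffLR (measurable_restrictT u (measurable_itv _)) um).
apply/andP; split; rewrite inE//= /finite_norm unlock poweR_lty//.
have C0 : 0 <= C by exact: le_trans (uC _ (lexx 0)).
apply: (@le_lt_trans _ _ (\int[mu]_t ((C `^ q)%:E * (\1_(`[0, 1]%classic : set R) t)%:E))%E).
  apply: ge0_le_integral => //.
  - by move=> t ?; rewrite /= lee_fin powR_ge0.
  - apply/measurable_EFinP; apply: (measurableT_comp (measurable_powR q)).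
    exact: (measurableT_comp _ um').
  - by apply: measurable_funeM; apply/measurable_EFinP; exact: measurable_indic.
  - move=> t _; rewrite /= -EFinM lee_fin patchE indicE !mem_setE !in_itv /= andbT.
    have [t0|t0] := leP 0 t; last by rewrite normr0 powR0 ?gt_eqF// mulr_ge0 ?powR_ge0.
    have [t1|/ltW t1] := leP t 1.
      by rewrite mulr1 ge0_ler_powR ?nnegrE ?(ltW q0)// uC.
    by rewrite u1// normr0 powR0 ?gt_eqF// mulr0.
rewrite ge0_integralZl_EFin ?powR_ge0//.
- by rewrite integral_indic01// mule1 ltry.
- by apply/measurable_EFinP; exact: measurable_indic.
Qed.

Lemma Rintegral_norm_le (f : R -> R) (c t : R) : 0 <= c -> 0 <= t -> t <= 1 ->
  mu.-integrable `[0, t] (EFin \o f) -> (forall s, 0 <= s -> s <= t -> `|f s| <= c) ->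
  `|\int[mu]_(s in `[0, t]) f s| <= c.
Proof.
move=> c0 t0 t1 fi fc; apply: (le_trans (le_normr_Rintegral _ fi)) => //.
apply: (@le_trans _ _ (\int[mu]_(s in `[0, t]) c)).
  apply: le_Rintegral => //.
  - exact: integrable_norm.
  - by apply: continuous_compact_integrable; [exact: segment_compact|move=> x; exact: cvg_cst].
  - by move=> s; rewrite /= in_itv /= => /andP[s0 st]; exact: fc.
by rewrite Rintegral_cst// [X in fine X]lebesgue_measure_itv0//= ler_piMr.
Qed.

(** Takes the place of Hölder's inequality in passing from L^q to L^1 on bounded intervals. *)
Lemma le_addr_powR q (c : R) : 1 <= q -> 0 <= c -> c <= 1 + c `^ q.
Proof.
move=> q1 c0; have [c1|/ltW c1] := leP c 1; first by rewrite (le_trans c1)// lerDl powR_ge0.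
by rewrite (le_trans (le1r_powR c1 q1))// lerDr.
Qed.

Lemma Lq_control_integrable q u t : 1 <= q -> Lq_control q u ->
  mu.-integrable `[0, t] (EFin \o u).
Proof.
move=> q1 uq.
have t0S : `[0, t] `<=` (`[0, +oo[%classic : set R).
  by move=> s; rewrite /= !in_itv /= => /andP[->].
have um : measurable_fun (`[0, t]%classic : set R) u.
  by apply: (measurable_funS _ t0S (Lq_control_measurable uq)).
apply: (@le_integrable _ _ _ mu _ _ _ (fun s => (1 + `|u s| `^ q)%:E)) => //.
- exact/measurable_EFinP.
- move=> s _; rewrite /= lee_fin [leRHS]ger0_norm ?addr_ge0 ?powR_ge0//.
  exact: le_addr_powR.
- have -> : (fun s => (1 + `|u s| `^ q)%:E) = (fun s => 1%:E + (`|u s| `^ q)%:E)%E by [].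
  apply: integrableD => //.
    by apply: continuous_compact_integrable; [exact: segment_compact|move=> x; exact: cvg_cst].
  by apply: (@integrableS _ _ _ mu `[0, +oo[%classic `[0, t]%classic _ _ _ t0S
    (Lq_control_integrable_powR q1 uq)).
Qed.

Section Fixed_dimension.
Context {n : nat}.
Implicit Types (x y : R -> 'cV[R]_n) (v : 'cV[R]_n).

Definition velocity v (c : R) (i : 'I_n) : R :=
  (jordan0 n *m v + c *: last_basis n) i 0.

Lemma velocityE v c i : velocity v c i =
  \sum_(j < n) (j == i.+1 :> nat)%:R * v j 0 + c * (i.+1 == n)%:R.
Proof. by rewrite /velocity !mxE; congr (_ + _); apply: eq_bigr => j _; rewrite mxE. Qed.

Lemma velocity_next v c (i j : 'I_n) : j = i.+1 :> nat -> velocity v c i = v j 0.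
Proof.
move=> ji; rewrite velocityE (bigD1 j)//= ji eqxx mul1r big1 ?addr0 => [|k kj].
  by rewrite -ji ltn_eqF ?mulr0 ?addr0 // ltn_ord.
by rewrite -ji val_eqE (negPf kj) mul0r.
Qed.

Lemma velocity_last v c (i : 'I_n) : i.+1 = n -> velocity v c i = c.
Proof.
move=> iN; rewrite velocityE iN eqxx mulr1 big1 ?add0r// => j _.
by rewrite ltn_eqF ?mul0r // ltn_ord.
Qed.

Lemma velocity_lin v v' c c' a b i :
  velocity (a *: v + b *: v') (a * c + b * c') i = a * velocity v c i + b * velocity v' c' i.
Proof.
rewrite /velocity mulmxDr -!scalemxAr scalerDl -!scalerA addrACA -!scalerDr.
by rewrite !mxE.
Qed.

Lemma velocity_integrable q u x t i : 1 <= q -> Lq_control q u ->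
  {within `[0, +oo[, continuous x} -> 0 <= t ->
  mu.-integrable `[0, t] (EFin \o (fun s => velocity (x s) (u s) i)).
Proof.
move=> q1 uq xc t0.
have -> : EFin \o (fun s => velocity (x s) (u s) i) =
    (fun s => ((jordan0 n *m x s) i 0)%:E + ((last_basis n : 'cV[R]_n) i 0)%:E * (u s)%:E)%E.
  by apply/funext => s; rewrite /velocity /= !mxE -EFinM -EFinD mulrC.
apply: integrableD => //; last first.
    by apply: (@integrableZl _ _ _ mu _ _ (last_basis n i 0) (EFin \o u)
      (Lq_control_integrable t q1 uq)).
apply: (@continuous_compact_integrable _ (fun s => (jordan0 n *m x s) i 0)).
  exact: segment_compact.
have t0S : `[0, t] `<=` (`[0, +oo[%classic : set R).
  by move=> s; rewrite /= !in_itv /= => /andP[->].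
apply: (continuous_subspaceW t0S).
apply: (@within_continuous_comp _ _ _ _ x (fun v => (jordan0 n *m v) i 0)) => // v _.
have -> : (fun v => (jordan0 n *m v) i 0) = dot (\col_j jordan0 n i j : 'cV[R]_n).
  by apply/funext => w; rewrite !mxE; apply: eq_bigr => j _; rewrite !mxE.
exact: dot_continuous.
Qed.

Lemma is_trajectory_lin q (x0 y0 : 'cV[R]_n) u w x y (a b : R) : 1 <= q ->
  Lq_control q u -> Lq_control q w ->
  is_trajectory x0 u x -> is_trajectory y0 w y ->
  is_trajectory (a *: x0 + b *: y0) (fun t => a * u t + b * w t)
    (fun t => a *: x t + b *: y t).
Proof.
move=> q1 uq wq [xc xE] [yc yE]; split.
  move=> t; apply: (@cvgD R 'cV[R]_n); apply: cvgZl_tmp; [exact: xc|exact: yc].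
move=> t t0 i; rewrite !mxE (xE t t0 i) (yE t t0 i) !mulrDr addrACA; congr (_ + _).
under [in RHS]eq_Rintegral do rewrite -/(velocity _ _ _) velocity_lin.
have xi := velocity_integrable i q1 uq xc t0.
have yi := velocity_integrable i q1 wq yc t0.
rewrite RintegralD ?RintegralZl//.
- exact: (integrableZl _ _ xi).
- exact: (integrableZl _ _ yi).
Qed.

End Fixed_dimension.
End Trajectories.

(** * Bounds on the unit interval and steering in unit time *)

Section Trajectory_bounds.
Context {R : realType} {n : nat}.
Local Notation mu := (@lebesgue_measure R).
Implicit Types (u w : R -> R) (q t : R) (v : 'cV[R]_n).

(** The system is a chain of integrators: the last coordinate integrates u and every other one
    integrates its successor. Going up from the last coordinate, each integration over at most unit
    time adds at most |x0|, so no Grönwall argument is required. *)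
Lemma trajectory_bound q (x0 : 'cV[R]_n) u (x : R -> 'cV[R]_n) (B : R) :
  1 <= q -> Lq_control q u -> is_trajectory x0 u x -> 0 <= B ->
  (forall t, 0 <= t -> t <= 1 -> `|\int[mu]_(s in `[0, t]) u s| <= B) ->
  forall t, 0 <= t -> t <= 1 -> `|x t| <= n%:R * `|x0| + B.
Proof.
move=> q1 uq [xc xE] B0 uB.
have claim k (i : 'I_n) t : n = (i + k.+1)%N -> 0 <= t -> t <= 1 ->
    `|x t i 0| <= k.+1%:R * `|x0| + B.
  elim: k i t => [|k IH] i t nE t0 t1; rewrite xE// (le_trans (ler_normD _ _))//.
    rewrite mul1r lerD ?norm_coord_le//.
    rewrite (@eq_Rintegral _ _ _ mu _ u).
      exact: uB.
    by move=> s _; apply: velocity_last; rewrite -addn1.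
  have iN : (i.+1 < n)%N by apply: leq_trans (eq_leq (esym nE)); rewrite !addnS !ltnS leq_addr.
  rewrite -natr1 mulrDl mul1r [_ + `|x0|]addrC -addrA lerD ?norm_coord_le//.
  apply: Rintegral_norm_le => //.
  - by rewrite addr_ge0// mulr_ge0.
  - exact: (velocity_integrable i q1 uq xc t0).
  - move=> s s0 st; rewrite -/(velocity _ _ _) (@velocity_next _ _ _ _ _ (Ordinal iN))//.
    by apply: IH => //=; [rewrite addSnnS|exact: le_trans t1].
move=> t t0 t1; apply: norm_cV_le => [|i]; first by rewrite addr_ge0// mulr_ge0.
apply: (le_trans (claim (n - i.+1)%N i t _ t0 t1)).
  by rewrite addnS -addSn subnKC// ltn_ord.
by rewrite lerD2r ler_wpM2r// ler_nat -subSn ?ltn_ord// subSS leq_subr.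
Qed.

Lemma cV_continuous {T : topologicalType} (f : T -> 'cV[R]_n) :
  (forall i : 'I_n, continuous (fun t : T => f t i 0)) -> continuous f.
Proof.
move=> fc t; apply/(@cvgrPdist_le _ 'cV[R]_n _ (nbhs t)) => e e0.
have : \forall s \near t, forall i : 'I_n, `|f t i 0 - f s i 0| <= e.
  apply: filter_forall => i.
  by have /(@cvgrPdist_le _ R _ (nbhs t)) := fc i t; apply.
apply: filterS => s H; apply: norm_cV_le => [|i]; first exact: ltW.
by rewrite !mxE; exact: H.
Qed.

(* With p^(j)(0) = h_j and p^(j)(1) = 0 for all j < n, the trajectory is
   (p, p', ..., p^(n-1)) and the control p^(n), both cut off at time 1. *)
Lemma steering q : 0 < q -> exists2 C : R, 0 < C & forall h : 'cV[R]_n,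
  exists w (y : R -> 'cV[R]_n), [/\ Lq_control q w, is_trajectory h w y,
    forall t, 0 <= t -> `|w t| <= C * `|h| /\ `|y t| <= C * `|h| &
    forall t, 1 <= t -> w t = 0 /\ y t = 0].
Proof.
move=> q0; have /choice[P PE] := @steering_poly R n.
have /choice[K KE] : forall i : 'I_n, exists K : nat -> R, forall k, 0 < K k /\
    forall t, 0 <= t -> t <= 1 -> `|((P i)^`(k)).[t]| <= K k.
  move=> i; have /choice[K HK] : forall k, exists C, 0 < C /\
      forall t, 0 <= t -> t <= 1 -> `|((P i)^`(k)).[t]| <= C.
    by move=> k; have [C C0 HC] := horner_bound ((P i)^`(k)); exists C.
  by exists K.
(* Derivatives up to order n inclusive are bounded, since the control is the n-th one. As p depends
   linearly on h, the bound scales with |h|. *)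
pose C := \sum_(i < n) \sum_(k < n.+1) K i k + 1.
have K0 i k : 0 <= K i k by exact: ltW (KE i k).1.
have C0 : 0 < C by rewrite ltr_wpDl// sumr_ge0// => i _; rewrite sumr_ge0.
exists C => // h; pose p := \sum_(i < n) h i 0 *: P i.
have pE k t : (p^`(k)).[t] = \sum_(i < n) h i 0 * ((P i)^`(k)).[t].
  rewrite /p raddf_sum horner_sum; apply: eq_bigr => i _.
  by rewrite /= derivnZ hornerZ.
have p1 k : (k < n)%N -> (p^`(k)).[1] = 0.
  by move=> kn; rewrite pE big1// => i _; rewrite (PE i k kn).2 mulr0.
have p0 (k : 'I_n) : (p^`(k)).[0] = h k 0.
  rewrite pE (bigD1 k)//= (PE k k _).1 // eqxx mulr1 big1 ?addr0// => i ik.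
  by rewrite (PE i k _).1// val_eqE (negPf ik) mulr0.
have bound k t : (k <= n)%N -> 0 <= t -> `|stopped (p^`(k)) t| <= C * `|h|.
  move=> kn t0; rewrite stoppedE; case: ifPn => [t1|_]; last first.
    by rewrite normr0 mulr_ge0// ltW.
  rewrite pE (le_trans (ler_norm_sum _ _ _))//.
  apply: (@le_trans _ _ (\sum_(i < n) \sum_(k < n.+1) K i k * `|h|)).
    apply: ler_sum => i _; rewrite -mulr_suml normrM mulrC ler_pM ?norm_coord_le//.
    apply: (le_trans ((KE i k).2 t t0 (ltW t1))).
    rewrite (bigD1 (Ordinal (kn : (k < n.+1)%N)))//= lerDl sumr_ge0//.
  under eq_bigr do rewrite -mulr_suml.
  by rewrite -mulr_suml ler_wpM2r// lerDl.
pose w := stopped (p^`(n)); pose y t : 'cV[R]_n := \col_k stopped (p^`(k)) t.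
have wm : measurable_fun (`[0, +oo[%classic : set R) w.
  apply: (@measurable_funS _ _ _ _ setT) => //.
  apply: (iffLR (measurable_restrictT (horner p^`(n)) (measurable_itv _))).
  apply: (@measurable_funS _ _ _ _ setT) => //.
  by apply: continuous_measurable_fun; exact: continuous_horner.
exists w, y; split.
- apply: (Lq_control_bounded q0 wm (C := C * `|h|)) => t t1.
    exact: bound.
  by rewrite /w stoppedE ltNge t1.
- split.
    apply: continuous_subspaceT; apply: cV_continuous => k.
    rewrite (_ : (fun t => y t k 0) = stopped (p^`(k))).
      by apply: stopped_continuous; exact: p1.
    by apply/funext => t; rewrite mxE.
  move=> t t0 i; rewrite mxE integral_stopped ?p1// p0; congr (_ + _).
  apply: eq_Rintegral => s _; rewrite -derivnS -/(velocity _ _ _).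
  have [iN|iN] := ltnP i.+1 n.
    by rewrite (@velocity_next _ _ _ _ _ (Ordinal iN))// mxE.
  have iE : i.+1 = n by apply/eqP; rewrite eqn_leq iN ltn_ord.
  by rewrite velocity_last// /w iE.
- move=> t t0; split; first exact: bound.
  apply: norm_cV_le => [|i]; first by rewrite mulr_ge0// ltW.
  by rewrite mxE bound// ltnW.
- move=> t t1; split; first by rewrite /w stoppedE ltNge t1.
  by apply/colP => i; rewrite !mxE stoppedE ltNge t1.
Qed.

End Trajectory_bounds.

(** * The value function *)

Section Value.
Context {R : realType} {n : nat}.
Local Notation mu := (@lebesgue_measure R).
Implicit Types (u w : R -> R) (t : R) (h : 'cV[R]_n).
Context (q : R) (F : 'cV[R]_n -> R) (kappa : R).
Context (q_gt1 : 1 < q) (F_convex : convex F) (dF : forall x, differentiable F x).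
Context (F0 : F 0 = 0) (F_ge0 : forall x, 0 <= F x).
Context (kappa_gt0 : 0 < kappa) (gradF_holder : locally_holder kappa (gradient F)).

Let q_ge1 : 1 <= q. Proof. exact: ltW. Qed.
Let q_gt0 : 0 < q. Proof. exact: lt_trans q_gt1. Qed.

Definition admissible (x0 : 'cV[R]_n) u (x : R -> 'cV[R]_n) :=
  Lq_control q u /\ is_trajectory x0 u x.

Definition running u (x : R -> 'cV[R]_n) t : R := `|u t| `^ q / q + F (x t).

Lemma running_ge0 u x t : 0 <= running u x t.
Proof. by rewrite addr_ge0// divr_ge0 ?powR_ge0// ltW. Qed.

Lemma running_measurable x0 u x : admissible x0 u x ->
  measurable_fun (`[0, +oo[%classic : set R) (running u x).
Proof.
move=> [uq [xc _]]; apply: measurable_funD.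
  apply: measurable_funM => //.
  apply: (measurableT_comp (measurable_powR q)).
  apply: (measurableT_comp (@normr_measurable R setT)).
  exact: Lq_control_measurable uq.
apply: subspace_continuous_measurable_fun => //.
apply: (@within_continuous_comp _ _ _ _ x F) => // v _.
exact: differentiable_continuous.
Qed.

Lemma integral_lin (f g : R -> R) (a b : R) : 0 <= a -> 0 <= b ->
  (forall t, 0 <= f t) -> (forall t, 0 <= g t) ->
  measurable_fun (`[0, +oo[%classic : set R) f ->
  measurable_fun (`[0, +oo[%classic : set R) g ->
  (\int[mu]_(t in `[0%R, +oo[) (a * f t + b * g t)%:E =
   a%:E * (\int[mu]_(t in `[0%R, +oo[) (f t)%:E) +
   b%:E * (\int[mu]_(t in `[0%R, +oo[) (g t)%:E))%E.
Proof.
move=> a0 b0 f0 g0 mf mg.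
under eq_integral do rewrite EFinD !EFinM.
rewrite ge0_integralD//; last 4 first.
- by move=> t _; rewrite -EFinM lee_fin mulr_ge0.
- by apply: measurable_funeM; exact/measurable_EFinP.
- by move=> t _; rewrite -EFinM lee_fin mulr_ge0.
- by apply: measurable_funeM; exact/measurable_EFinP.
rewrite !ge0_integralZl_EFin// => [t _||t _|]; rewrite ?lee_fin//; exact/measurable_EFinP.
Qed.

(** Two costs are compared with one integrand because the second-difference estimate bounds the
    perturbed running costs only in sum, not separately. *)
Lemma cost_comb_le x1 u1 x1' u1' (f : R -> R) (a b : R) (x0 x0' : 'cV[R]_n) :
  0 <= a -> 0 <= b -> admissible x0 u1 x1 -> admissible x0' u1' x1' ->
  measurable_fun (`[0, +oo[%classic : set R) f ->
  (forall t, 0 <= t -> a * running u1 x1 t + b * running u1' x1' t <= f t) ->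
  (a%:E * cost q F u1 x1 + b%:E * cost q F u1' x1' <=
   \int[mu]_(t in `[0%R, +oo[) (f t)%:E)%E.
Proof.
move=> a0 b0 A1 A2 mf H.
have m1 := running_measurable A1; have m2 := running_measurable A2.
rewrite -(integral_lin a0 b0 (running_ge0 _ _) (running_ge0 _ _) m1 m2).
apply: ge0_le_integral => //.
- by move=> t _; rewrite lee_fin addr_ge0// mulr_ge0// running_ge0.
- by apply/measurable_EFinP; apply: measurable_funD; apply: measurable_funM.
- exact/measurable_EFinP.
- by move=> t; rewrite /= in_itv /= andbT => t0; rewrite lee_fin H.
Qed.

Lemma cost_le x0 u x (f : R -> R) : admissible x0 u x ->
  measurable_fun (`[0, +oo[%classic : set R) f ->
  (forall t, 0 <= t -> running u x t <= f t) ->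
  (cost q F u x <= \int[mu]_(t in `[0%R, +oo[) (f t)%:E)%E.
Proof.
move=> A mf H; have := cost_comb_le (a := 1) (b := 0) ler01 (lexx 0) A A mf.
rewrite mul1e mul0e adde0; apply => t t0.
by rewrite mul1r mul0r addr0 H.
Qed.

(** The shape of the majorants used below: the part proportional to the running cost absorbs |u|^q,
    and the constant part lives on the unit interval, where the steering acts. *)
Definition bump (c A : R) u x t := c * running u x t + A * \1_(`[0, 1]%classic : set R) t.

Lemma bump_integral x0 u x (c A : R) : admissible x0 u x -> 0 <= c -> 0 <= A ->
  measurable_fun (`[0, +oo[%classic : set R) (bump c A u x) /\
  (\int[mu]_(t in `[0%R, +oo[) (bump c A u x t)%:E = c%:E * cost q F u x + A%:E)%E.
Proof.
move=> Aux c0 A0; have m1 := running_measurable Aux.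
have mi : measurable_fun (`[0, +oo[%classic : set R) (\1_(`[0, 1]%classic : set R) : R -> R).
  exact: measurable_indic.
split; first by apply: measurable_funD; apply: measurable_funM.
rewrite integral_lin ?integral_indic01 ?mule1//.
  by move=> t; rewrite /= !in_itv /= andbT => /andP[].
by move=> t; exact: running_ge0.
Qed.

Lemma cost_ge0 u x : (0 <= cost q F u x)%E.
Proof. by apply: integral_ge0 => t _; rewrite lee_fin running_ge0. Qed.

Lemma admissible_lin (x0 y0 : 'cV[R]_n) u w x y (a b : R) :
  admissible x0 u x -> admissible y0 w y ->
  admissible (a *: x0 + b *: y0) (fun t => a * u t + b * w t) (fun t => a *: x t + b *: y t).
Proof.
move=> [uq xt] [wq yt]; split; first exact: Lq_control_lin.
exact: (is_trajectory_lin _ _ q_ge1 uq wq).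
Qed.

(** Makes the value finite and bounds it uniformly on balls, hence also the costs of nearly optimal
    pairs. *)
Lemma steering_cost r : exists2 M : R, 0 < M & forall h, `|h| <= r ->
  exists w y, admissible h w y /\ (cost q F w y <= M%:E)%E.
Proof.
have [C C0 HC] := @steering R n q q_gt0.
have [K K0 HK] := convex_holder_bounded kappa_gt0 F_convex dF gradF_holder (C * r).
pose M := (C * `|r|) `^ q / q + K.
have M0 : 0 < M by rewrite ltr_wpDl// divr_ge0 ?powR_ge0// ltW.
exists M => // h hr; have [w [y [wq yt bd z]]] := HC h.
exists w, y; split=> //.
have A : admissible h w y by [].
have [] := bump_integral A (lexx 0) (ltW M0); rewrite mul0e add0e => mb <-.
apply: (cost_le A mb) => t t0; rewrite /bump mul0r add0r indicE mem_setE in_itv /= t0 /=.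
have [t1|/ltW t1] := leP t 1; last first.
  have [w0 y0] := z t t1; rewrite /running w0 y0 F0 normr0 powR0 ?gt_eqF//.
  by rewrite mul0r addr0 mulr0.
have [wb yb] := bd t t0; rewrite mulr1 lerD//.
  rewrite ler_pM2r ?invr_gt0// ge0_ler_powR ?nnegrE ?(ltW q_gt0)//.
    by rewrite mulr_ge0// ltW.
  by rewrite (le_trans wb)// ler_wpM2l ?(ltW C0)// (le_trans hr)// ler_norm.
by rewrite HK// (le_trans yb)// ler_wpM2l// ltW.
Qed.

Lemma value_fin_num x0 : value q F x0 \is a fin_num.
Proof.
rewrite ge0_fin_numE; last first.
  by apply: le_ereal_inf_tmp => _ [u [x [_ _ ->]]]; exact: cost_ge0.
have [M M0 /(_ x0 (lexx _))[w [y [[wq yt] H]]]] := steering_cost `|x0|.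
apply: le_lt_trans (ltry M); apply: le_trans H.
by apply: ereal_inf_lbound; exists w, y.
Qed.

Let V x0 : R := fine (value q F x0).

Lemma value_le x0 u x : admissible x0 u x -> ((V x0)%:E <= cost q F u x)%E.
Proof.
move=> [uq xt]; rewrite fineK ?value_fin_num//.
by apply: ereal_inf_lbound; exists u, x.
Qed.

Lemma value_near_optimal x0 (e : R) : 0 < e ->
  exists u x, admissible x0 u x /\ (cost q F u x <= (V x0 + e)%:E)%E.
Proof.
move=> e0; have [_ [u [x [uq xt ->]]] H] := lb_ereal_inf_adherent e0 (value_fin_num x0).
by exists u, x; split=> //; rewrite EFinD fineK ?value_fin_num// ltW.
Qed.

Lemma norm_powR_convex (a b s : R) : 0 <= s -> s <= 1 ->
  `|s * a + (1 - s) * b| `^ q <= s * `|a| `^ q + (1 - s) * `|b| `^ q.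
Proof.
move=> s0 s1; have s1' : 0 <= 1 - s by rewrite subr_ge0.
apply: (@le_trans _ _ ((s * `|a| + (1 - s) * `|b|) `^ q)).
  rewrite ge0_ler_powR ?nnegrE ?(ltW q_gt0)// ?addr_ge0 ?mulr_ge0//.
  by rewrite (le_trans (ler_normD _ _))// !normrM (ger0_norm s0) (ger0_norm s1').
by apply: (convex_powR q_ge1 (Itv01 s0 s1)); rewrite inE /= in_itv /= andbT.
Qed.

Lemma value_convex : convex V.
Proof.
move=> x0 y0 s s0 s1; have s1' : 0 <= 1 - s by rewrite subr_ge0.
apply/ler_addgt0Pr => e e0.
have [u [x [Au Hu]]] := value_near_optimal x0 e0.
have [w [y [Aw Hw]]] := value_near_optimal y0 e0.
have A := admissible_lin s (1 - s) Au Aw.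
rewrite -lee_fin; apply: (le_trans (value_le A)).
have H1 : (cost q F (fun t => s * u t + (1 - s) * w t)%R (fun t => s *: x t + (1 - s) *: y t)%R <=
   s%:E * cost q F u x + (1 - s)%:E * cost q F w y)%E.
  have m1 := running_measurable Au; have m2 := running_measurable Aw.
  rewrite -(integral_lin s0 s1' (running_ge0 _ _) (running_ge0 _ _) m1 m2).
  apply: (cost_le A); first by apply: measurable_funD; apply: measurable_funM.
  move=> t t0; rewrite /running !mulrDr addrACA lerD//; last exact: F_convex.
  by rewrite !mulrA -mulrDl ler_pM2r ?invr_gt0// norm_powR_convex.
apply: (le_trans H1); apply: (@le_trans _ _ (s * (V x0 + e) + (1 - s) * (V y0 + e))%:E).
  by rewrite [leRHS]EFinD ![in leRHS]EFinM leeD// lee_wpmul2l.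
by rewrite lee_fin; lra.
Qed.

(** On [0, 1], |u| <= 1 + |u|^q, and |u|^q is at most q times the running cost. *)
Lemma integral_control_le (x0 : 'cV[R]_n) u x (J t : R) : admissible x0 u x ->
  (cost q F u x <= J%:E)%E -> 0 <= t -> t <= 1 ->
  `|\int[mu]_(s in `[0, t]) u s| <= 1 + q * J.
Proof.
move=> A HJ t0 t1; have [uq _] := A.
have ui := Lq_control_integrable t q_ge1 uq.
have [mb bE] := bump_integral A (ltW q_gt0) ler01.
have tS : `[0, t] `<=` (`[0, +oo[%classic : set R).
  by move=> s; rewrite /= !in_itv /= => /andP[->].
have bump_ge0 s : 0 <= bump q 1 u x s.
  by rewrite addr_ge0// mulr_ge0 ?running_ge0 ?(ltW q_gt0).
rewrite -lee_fin EFin_normr_Rintegral//.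
apply: (le_trans (le_abse_integral _ _ _)) => //; first by move/integrableP: ui => [].
apply: (@le_trans _ _ (\int[mu]_(s in `[0%R, t]) (bump q 1 u x s)%:E)%E).
  apply: ge0_le_integral => //.
  - by have /integrable_abse/integrableP[] := ui.
  - by apply/measurable_EFinP; exact: (measurable_funS _ tS mb).
  - move=> s; rewrite /= in_itv /= => /andP[s0 st]; rewrite lee_fin.
    apply: (le_trans (le_addr_powR q_ge1 (normr_ge0 _))).
    rewrite /bump indicE mem_setE in_itv /= s0 (le_trans st t1) mulr1 addrC lerD2r.
    by rewrite /running mulrDr mulrCA divff ?gt_eqF// mulr1 lerDl mulr_ge0// ltW.
apply: (@le_trans _ _ (\int[mu]_(s in `[0%R, +oo[) (bump q 1 u x s)%:E)%E).
  apply: ge0_subset_integral => //; first exact/measurable_EFinP.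
  by move=> s _; rewrite lee_fin.
by rewrite bE addeC EFinD EFinM leeD2l// lee_wpmul2l// lee_fin ltW.
Qed.

Lemma value_second_difference (a : R) : 0 < a -> a <= 1 -> a <= q - 1 -> a <= kappa ->
  forall r, exists2 C, 0 < C & forall x0 h, `|x0| <= r -> `|h| <= r ->
    V (x0 + h) + V (x0 - h) - 2 * V x0 <= C * `|h| `^ (1 + a).
Proof.
move=> a0 a1 aq ak r.
have [M M0 HM] := steering_cost r.
have [C C0 HC] := @steering R n q q_gt0.
have Cr0 : 0 <= C * `|r| by rewrite mulr_ge0// ltW.
have [K K0 HK] := powR_second_difference q_gt1 a0 a1 aq Cr0.
(* [B] bounds the integrals of a control of cost at most M + 1. In [r2] below, the first two terms
   bound x on [0, 1] and the last one bounds y. *)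
pose B := 1 + q * (M + 1).
have B0 : 0 <= B by rewrite addr_ge0// mulr_ge0 ?addr_ge0 // ltW.
pose r2 := n%:R * `|r| + B + C * `|r|.
have [L L0 HL] := convex_holder_second_difference kappa_gt0 F_convex dF gradF_holder r2.
have a10 : 0 < 1 + a by rewrite addr_gt0.
pose K' := K * C `^ (1 + a) / q; pose L' := L * (C * `|r|) `^ (kappa - a) * C `^ (1 + a).
have K'0 : 0 < K' by rewrite divr_gt0// mulr_gt0// powR_gt0.
have L'0 : 0 <= L' by rewrite !mulr_ge0 ?powR_ge0// ltW.
have K'E : K' * q = K * C `^ (1 + a) by rewrite /K' divfK// gt_eqF.
have L'E : L' = L * (C * `|r|) `^ (kappa - a) * C `^ (1 + a) by [].
clearbody K' L'.
have KqM0 : 0 < K' * q * (M + 1) by rewrite !mulr_gt0// addr_gt0.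
exists (K' * q * (M + 1) + K' + L'); first by rewrite ltr_wpDr// addr_gt0.
move=> x0 h xr hr; set c := `|h| `^ (1 + a); have c0 : 0 <= c by exact: powR_ge0.
apply/ler_addgt0Pr => e e0.
(* The bound 1 keeps the cost below M + 1 whatever e is; the half is there because the near-optimal
   cost is counted twice. *)
pose e' := Num.min 1 (e / 2); have e'0 : 0 < e' by rewrite lt_min ltr01 divr_gt0.
have e'1 : e' <= 1 by rewrite ge_min lexx.
have e'2 : e' <= e / 2 by rewrite ge_min lexx orbT.
have [u [x [Au Hu]]] := value_near_optimal x0 e'0.
have VM : V x0 + e' <= M + 1.
  rewrite lerD//; have [w [y [Aw Hw]]] := HM x0 xr.
  by rewrite -lee_fin (le_trans (value_le Aw)).
have Hu1 : (cost q F u x <= (M + 1)%:E)%E by rewrite (le_trans Hu)// lee_fin.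
have [uq xt] := Au.
have xb t : 0 <= t -> t <= 1 -> `|x t| <= r2.
  move=> t0 t1; have := trajectory_bound q_ge1 uq xt B0 _ t0 t1.
  move=> /(_ (fun s => integral_control_le Au Hu1 (t := s))) /le_trans; apply.
  by rewrite /r2 -[leLHS]addr0 lerD// lerD2r ler_wpM2l// (le_trans xr)// ler_norm.
have [w [y [wq yt bd z]]] := HC h; have Aw : admissible h w y by [].
have Ap := admissible_lin 1 1 Au Aw; have Am := admissible_lin 1 (- 1) Au Aw.
have A0 : 0 <= (K' + L') * c by rewrite mulr_ge0// addr_ge0// ltW.
have c20 : 0 <= 2 + K' * q * c by rewrite addr_ge0// !mulr_ge0// ltW.
have [mb bE] := bump_integral Au c20 A0.
have chr : C * `|h| <= C * `|r| by rewrite ler_wpM2l ?(ltW C0)// (le_trans hr)// ler_norm.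
have Ch0 : 0 <= C * `|h| by rewrite mulr_ge0// ltW.
have ChE : (C * `|h|) `^ (1 + a) = C `^ (1 + a) * c by rewrite powRM// ltW.
(* The control term K'(1 + |u|^q)c splits into the constant K'c, put on the unit interval, and K'qc
   times |u|^q/q, which is at most K'qc times the running cost because F is nonnegative. *)
have pointwise : forall t, 0 <= t ->
    1 * running (fun s => 1 * u s + 1 * w s) (fun s => 1 *: x s + 1 *: y s) t +
    1 * running (fun s => 1 * u s + - 1 * w s) (fun s => 1 *: x s + - 1 *: y s) t <=
    bump (2 + K' * q * c) ((K' + L') * c) u x t.
  move=> t t0; rewrite /running /= !mul1r !mulN1r !scale1r !scaleN1r.
  rewrite /bump indicE mem_setE in_itv /= t0 /=.
  have [t1|/ltW t1] := leP t 1; last first.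
    have [-> ->] := z t t1; rewrite !subr0 !addr0 mulr0 addr0 mulrDl.
    rewrite -[2 * _]/(2%:R * _) mulr_natl mulr2n lerDl mulr_ge0 ?running_ge0//.
    by rewrite !mulr_ge0// ltW.
  have [wb yb] := bd t t0; rewrite mulr1.
  have := HK (u t) (w t) (le_trans wb chr).
  have yr2 : `|y t| <= r2.
    by rewrite (le_trans yb)// (le_trans chr)// /r2 lerDr addr_ge0// mulr_ge0.
  have := HL (x t) (y t) (xb t t0 t1) yr2.
  have wP : `|w t| `^ (1 + a) <= C `^ (1 + a) * c.
    by rewrite -ChE ge0_ler_powR ?nnegrE ?(ltW a10).
  have yP : `|y t| `^ (1 + kappa) <= (C * `|r|) `^ (kappa - a) * (C `^ (1 + a) * c).
    apply: (@le_trans _ _ ((C * `|h|) `^ (1 + kappa))).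
      by rewrite ge0_ler_powR ?nnegrE// addr_ge0// ltW.
    rewrite -ChE; have := powR_split_le Ch0 chr a10 (_ : 1 + a <= 1 + kappa).
    by rewrite opprD addrACA subrr add0r; apply; rewrite lerD2l.
  have := F_ge0 (x t).
  set U := `|u t| `^ q; have U0 : 0 <= U by exact: powR_ge0.
  set Up := `|u t + w t| `^ q; set Um := `|u t - w t| `^ q.
  set Fp := F (x t + y t); set Fm := F (x t - y t); set F0' := F (x t).
  move=> F0'0 FH UH.
  have FH' : Fp + Fm - 2 * F0' <= L' * c.
    by apply: (le_trans FH); rewrite L'E -!mulrA ler_wpM2l// ltW.
  have UH' : Up / q + Um / q - 2 * (U / q) <= K' * (1 + U) * c.
    have -> : Up / q + Um / q - 2 * (U / q) = (Up + Um - 2 * U) / q by field; rewrite gt_eqF.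
    rewrite ler_pdivrMr//; apply: (le_trans UH).
    have -> : K' * (1 + U) * c * q = K * (1 + U) * (C `^ (1 + a) * c).
      have -> : K' * (1 + U) * c * q = K' * q * ((1 + U) * c) by ring.
      by rewrite K'E; ring.
    by rewrite ler_wpM2l// mulr_ge0 ?addr_ge0// ltW.
  have -> : (2 + K' * q * c) * (U / q + F0') + (K' + L') * c =
    2 * (U / q) + 2 * F0' + K' * (1 + U) * c + K' * q * c * F0' + L' * c.
    by field; rewrite gt_eqF.
  have : 0 <= K' * q * c * F0' by rewrite !mulr_ge0// ltW.
  move: UH' FH'; clear.
  by move: (K' * (1 + U) * c) (K' * q * c * F0') (L' * c) (U / q) (Up / q) (Um / q) => *; lra.
have := cost_comb_le ler01 ler01 Ap Am mb pointwise; rewrite !mul1e bE => H.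
have Vp := value_le Ap; have Vm := value_le Am.
have {}H : V (x0 + h) + V (x0 - h) <= (2 + K' * q * c) * (V x0 + e') + (K' + L') * c.
  rewrite -lee_fin.
  apply: (@le_trans _ _ ((2 + K' * q * c)%:E * cost q F u x + ((K' + L') * c)%:E)%E).
    apply: le_trans H; rewrite EFinD; apply: leeD.
      by move: Vp; rewrite !scale1r.
    by move: Vm; rewrite scale1r scaleN1r.
  by rewrite [leRHS]EFinD [in leRHS]EFinM leeD2r// lee_wpmul2l// lee_fin.
have H2 : K' * q * c * (V x0 + e') <= K' * q * c * (M + 1).
  by rewrite ler_wpM2l// !mulr_ge0// ltW.
rewrite lerBlDr; apply: (le_trans H).
have -> : (K' * q * (M + 1) + K' + L') * c = K' * q * c * (M + 1) + (K' + L') * c by ring.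
rewrite mulrDl.
by move: H2 e'2; move: (K' * q * c * _) (K' * q * c * _) ((K' + L') * c) => *; lra.
Qed.

End Value.

(** Finiteness and continuous differentiability belong to the conclusion: [fine] would hide an
    infinite value, and [gradient] alone is just a vector of directional derivatives. *)
Theorem proposition4p5 (R : realType) (n : nat) (n_ge1 : (1 <= n)%N)
  (q : R) (q_gt1 : 1 < q)
  (F : 'cV[R]_n -> R) (F_C1 : C1 F)
  (F_convex : convex_function [set: 'cV[R]_n] F)
  (F0 : F 0 = 0) (F_gt0 : forall x, x != 0 -> 0 < F x)
  (kappa : R) (kappa_gt0 : 0 < kappa) (kappa_lt1 : kappa < 1)
  (gradF_holder : locally_holder kappa (gradient F)) :
  let V := fun x0 : 'cV[R]_n => fine (value q F x0) in
  [/\ forall x0, value q F x0 \is a fin_num,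
      C1 V &
      locally_holder (Num.min (q - 1) kappa) (gradient V)].
Proof.
move=> V; set a := Num.min _ _.
have Fc := convex_functionT F_convex; have dF := F_C1.1.
have F_ge0 x : 0 <= F x by have [->|/F_gt0/ltW//] := eqVneq x 0; rewrite F0.
have a0 : 0 < a by rewrite lt_min subr_gt0 q_gt1.
have aq : a <= q - 1 by rewrite ge_min lexx.
have ak : a <= kappa by rewrite ge_min lexx orbT.
(* With a <= q - 1 this gives 1 + a <= min(q, 2), the order available from the control term. *)
have a1 : a <= 1 by exact: le_trans ak (ltW kappa_lt1).
have Vfin x0 : value q F x0 \is a fin_num by exact: (value_fin_num q_gt1 Fc dF F0 F_ge0 kappa_gt0).
have Vc : convex V by exact: (value_convex q_gt1 Fc dF F0 F_ge0 kappa_gt0).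
have [dV VE] := convex_second_difference_C1_expansion Vc a0
  (value_second_difference q_gt1 Fc dF F0 F_ge0 kappa_gt0 gradF_holder a0 a1 aq ak).
have holderV := C1_expansion_holder a0 VE.
by split=> //; split=> //; exact: locally_holder_continuous a0 holderV.
Qed.
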